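(* Let $p \equiv 5 \pmod 6$ be prime and let $b \in \mathbb{F}_{p}^{*}$. Then $$\sum_{t=0}^{p-1}a_{p,\,t,\,b}^{2}= p\left(p-1 - \left(\frac{-1}{p}\right)\right).$$
   Context: $\mathbb{F}_p$ is the field with $p$ elements, $\mathbb{F}_p^*=\mathbb{F}_p\setminus\{0\}$, and $\left(\frac{\cdot}{p}\right)$ is the Legendre symbol modulo $p$, with $\left(\frac{0}{p}\right)=0$. For $a,b\in\mathbb{F}_p$, let $E_{a,b}$ be the curve $y^2=x^3+ax+b$ over $\mathbb{F}_p$, and define the integer $a_{p,\,a,\,b}$ by $\#E_{a,b}(\mathbb{F}_p)=p+1-a_{p,\,a,\,b}$ (points counted including the one point at infinity); equivalently $a_{p,\,a,\,b}=-\sum_{x\in\mathbb{F}_p}\left(\frac{x^3+ax+b}{p}\right)$. This formula is used for all pairs $(a,b)$, including those with $4a^3+27b^2=0$. A sum over $t=0,\dots,p-1$ is a sum over $t\in\mathbb{F}_p$. *)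

(* Defs.v *)
From mathcomp Require Import all_boot all_order all_algebra.

Set Implicit Arguments.
Unset Strict Implicit.
Unset Printing Implicit Defensive.

Import GRing.Theory.
Local Open Scope ring_scope.

(* All definitions below are meant for p prime: for other p, the type 'F_p is
   the prime field of another characteristic. *)

Definition legendre (p : nat) (x : 'F_p) : int :=
  if x == 0 then 0 else if [exists y : 'F_p, y ^+ 2 == x] then 1 else -1.

(* [None] is the point at infinity. The curve may be singular. *)
Definition curve_points (p : nat) (a b : 'F_p) : {set option ('F_p * 'F_p)} :=
  [set P | if P is Some (x, y) then y ^+ 2 == x ^+ 3 + a * x + b else true].

Definition frob_trace (p : nat) (a b : 'F_p) : int :=
  p%:Z + 1 - #|curve_points a b|%:Z.

Arguments legendre : clear implicits.
Arguments frob_trace : clear implicits.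

(* Main.v *)
Require Import Defs.
From mathcomp Require Import all_boot all_order all_algebra.
From mathcomp Require Import all_field zify ring.

Import GRing.Theory.
Local Open Scope ring_scope.

(** Write chi for the Legendre symbol. Counting points fibrewise over [x],
    the trace is minus the sum of [chi (x ^+ 3 + t * x + b)] over [x], so its
    second moment over [t] is a sum over pairs [(x, y)] of
      [\sum_t chi (x ^+ 3 + b + t * x) * chi (y ^+ 3 + b + t * y)].

    For [x = 0] only [y = 0] survives and contributes [p]. For [x != 0], put
    [y = m * x]; the sum over [t] becomes a correlation of chi with an affine
    translate of itself, which [sum_legendre_affine_corr] evaluates: it is
    [chi m * (p - 1)] or [- chi m], the first when
      [(m * x) ^+ 3 + b = m * (x ^+ 3 + b)],
    that is, when [(m - 1) * (m * (m + 1) * x ^+ 3 - b) = 0]. As chi sums to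
    zero, only [p] times the sum of [chi m] over the solutions [(m, x)] with
    [x != 0] is left. The factor [m = 1] allows every [x != 0]. For the other
    nonzero [m], the congruence on [p] makes cubing a bijection, so there is
    one [x] unless [m = -1], when there is none ([card_proportional]). Summing,
      [p + p * ((p - 1) + (0 - chi 1 - chi (-1))) = p * (p - 1 - chi (-1))]. *)

(** * The quadratic character of an odd prime field *)

Lemma sum_card_fibres (I J : finType) (P : I -> J -> bool) :
  #|[set u : I * J | P u.1 u.2]|%:Z = \sum_i #|[set j | P i j]|%:Z.
Proof.
rewrite cardsE -sum1_card -(pair_big_dep xpredT P (fun _ _ => 1%N)) /=.
rewrite -natz natr_sum; apply: eq_bigr => i _.
by rewrite natz sum1_card cardsE.
Qed.

Section QuadraticCharacter.

Variables (p : nat) (p_prime : prime p) (p_odd : odd p).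
Local Notation chi := (legendre p).

Lemma legendre0 : chi 0 = 0.
Proof. by rewrite /legendre eqxx. Qed.

Lemma legendre_sqr (y : 'F_p) : y != 0 -> chi (y ^+ 2) = 1.
Proof.
by move=> y0; rewrite /legendre sqrf_eq0 (negPf y0); case: existsP => // -[]; exists y.
Qed.

Lemma legendre1 : chi 1 = 1.
Proof. by rewrite -(expr1n _ 2) legendre_sqr // oner_neq0. Qed.

Lemma legendre_square_mul (y x : 'F_p) : y != 0 -> chi (y ^+ 2 * x) = chi x.
Proof.
move=> y0; rewrite /legendre mulf_eq0 sqrf_eq0 (negPf y0) /=.
case: eqP => // _; congr (if _ then _ else _).
apply/existsP/existsP => -[z /eqP zE].
  by exists (z / y); rewrite expr_div_n zE mulrC mulKf // sqrf_eq0.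
by exists (y * z); rewrite exprMn zE.
Qed.

Lemma oppr_neq_Fp (y : 'F_p) : y != 0 -> y != - y.
Proof.
move=> y0; rewrite -subr_eq0 opprK -mulr2n -mulr_natr mulf_neq0 //.
rewrite -(dvdn_pcharf (pchar_Fp p_prime)); apply/negP => /dvdn_leq.
by have := prime_gt1 p_prime; lia.
Qed.

Lemma card_sqrt_Fp (v : 'F_p) : #|[set y : 'F_p | y ^+ 2 == v]|%:Z = 1 + chi v.
Proof.
rewrite /legendre; case: eqP => [->|/eqP v0].
  rewrite (_ : [set _ | _] = [set 0]) ?cards1 //.
  by apply/setP => y; rewrite !inE sqrf_eq0.
case: existsP => [[y /eqP yE]|noroot].
  have y0 : y != 0 by move: v0; rewrite -yE sqrf_eq0.
  rewrite (_ : [set _ | _] = [set y; - y]) ?cards2 ?oppr_neq_Fp //.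
  by apply/setP => z; rewrite !inE -yE eqf_sqr.
rewrite (_ : [set _ | _] = set0) ?cards0 //.
by apply/setP => y; rewrite !inE; apply/negP => yv; apply: noroot; exists y.
Qed.

Lemma sumr_const_Fp (c : int) : \sum_(x : 'F_p) c = p%:Z * c.
Proof. by rewrite sumr_const card_Fp // -mulr_natl natz. Qed.

Lemma sum_nonzero_Fp : \sum_(x : 'F_p | x != 0) 1 = p%:Z - 1.
Proof.
by rewrite -[p%:Z]mulr1 -sumr_const_Fp [in RHS](bigD1 0) //= addrAC subrr add0r.
Qed.

(** Every element has exactly one square, so the numbers [1 + chi v] of
    square roots add up to [p]. *)
Lemma sum_legendre : \sum_(v : 'F_p) chi v = 0.
Proof.
have : \sum_(v : 'F_p) #|[set y : 'F_p | y ^+ 2 == v]|%:Z = p%:Z.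
  rewrite -(sum_card_fibres _ _ (fun v y : 'F_p => y ^+ 2 == v)).
  rewrite -[in RHS](card_Fp p_prime).
  rewrite -(card_imset predT (f := fun y : 'F_p => (y ^+ 2, y))); last by move=> y z [].
  congr (_%:Z); apply: eq_card => -[v y]; rewrite inE /=.
  apply/eqP/imsetP => [<-|[z _ [-> ->]] //]; by exists y.
under eq_bigr do rewrite card_sqrt_Fp.
by rewrite big_split /= sumr_const_Fp mulr1 => /(canRL (addKr _)); rewrite addNr.
Qed.

Lemma sum_legendre_affine (a c : 'F_p) :
  a != 0 -> \sum_(t : 'F_p) chi (a * t + c) = 0.
Proof.
move=> a0; rewrite -[RHS]sum_legendre [RHS](reindex_inj (h := fun t => a * t + c)) //.
by move=> t u /addIr/(mulfI a0).
Qed.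

(** For a nonresidue [a], both [chi (a * x)] and [chi x] sum to zero over
    [x]; as [chi (a * x) = - 1] when [chi x = 1], the terms
    [chi (a * x) + chi x] are nonpositive and therefore all vanish. This
    gives the product of two nonresidues without a primitive root. *)
Lemma legendreM (a x : 'F_p) : chi (a * x) = chi a * chi x.
Proof.
have [->|a0] := eqVneq a 0; first by rewrite mul0r legendre0 mul0r.
have chi_square (c : 'F_p) : c != 0 -> [exists y : 'F_p, y ^+ 2 == c] ->
    forall z, chi (c * z) = chi z.
  move=> c0 /existsP[y /eqP yE] z; rewrite -yE legendre_square_mul //.
  by move: c0; rewrite -yE sqrf_eq0.
have [sq|nsq] := boolP [exists y : 'F_p, y ^+ 2 == a].
  by rewrite chi_square // {2}/legendre (negPf a0) sq mul1r.
have chia : chi a = -1 by rewrite /legendre (negPf a0) (negPf nsq).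
have le0 z : 0 <= - (chi (a * z) + chi z).
  have [->|z0] := eqVneq z 0; first by rewrite mulr0 legendre0.
  have [sqz|nsqz] := boolP [exists y : 'F_p, y ^+ 2 == z].
    by rewrite mulrC chi_square // chia /legendre (negPf z0) sqz.
  rewrite {2}/legendre (negPf z0) (negPf nsqz).
  by rewrite /legendre; do 2?case: ifP.
have sum0 : \sum_z - (chi (a * z) + chi z) = 0.
  rewrite sumrN big_split /= sum_legendre addr0.
  by under eq_bigr do rewrite -[a * _]addr0; rewrite sum_legendre_affine ?oppr0.
have/eqP := Num.Theory.psumr_eq0P (fun z _ => le0 z) sum0 (i := x) isT.
by rewrite oppr_eq0 addr_eq0 chia mulN1r => /eqP.
Qed.

Lemma legendreM_self (s : 'F_p) : chi s * chi s = (s != 0)%:R.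
Proof.
by rewrite -legendreM; have [->|s0] := eqVneq s 0; rewrite ?mulr0 ?legendre0 ?legendre_sqr.
Qed.

(** For [c != 0] and [s != 0], the product [chi s * chi (m * s + c)] is
    [chi (m + c / s)]: the sum is that of [chi] over the affine image of
    the nonzero elements, so it misses a zero sum by the term [chi m]. *)
Lemma sum_legendre_affine_corr (m c : 'F_p) :
  \sum_(s : 'F_p) chi s * chi (m * s + c) = chi m * (p%:Z * (c == 0)%:R - 1).
Proof.
have [->|c0] := eqVneq c 0.
  under eq_bigr do rewrite addr0 legendreM mulrCA legendreM_self.
  rewrite -mulr_sumr mulr1; congr (_ * _).
  rewrite (bigD1 0) //= add0r (eq_bigr (fun=> 1)) => [|s /negPf-> //].
  exact: sum_nonzero_Fp.
rewrite (bigD1 0) //= legendre0 mul0r add0r.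
have := sum_legendre_affine c m c0.
rewrite (bigD1 0) //= mulr0 add0r => sum0.
rewrite mulr0 sub0r mulrN1; apply/eqP; rewrite -addr_eq0 addrC -{2}sum0.
rewrite (reindex_inj invr_inj) /=; apply/eqP; congr (_ + _).
apply: eq_big => [s|s s0]; first by rewrite invr_eq0.
rewrite -legendreM -(legendre_square_mul s (_ * _)); last by rewrite -invr_eq0.
congr (chi _); have s1 : s != 0 by rewrite -invr_eq0.
by field.
Qed.

Lemma frob_traceE (a b : 'F_p) :
  frob_trace p a b = - \sum_(x : 'F_p) chi (x ^+ 3 + a * x + b).
Proof.
rewrite /frob_trace.
have -> : #|curve_points a b| =
    #|[set u : 'F_p * 'F_p | u.2 ^+ 2 == u.1 ^+ 3 + a * u.1 + b]|.+1.
  rewrite (cardsD1 None) inE add1n; congr _.+1.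
  rewrite -[RHS](card_imset _ (@Some_inj _)).
  apply: eq_card => -[[x y]|]; rewrite !inE /=.
    apply/idP/imsetP => [e|[[u v]]]; first by exists (x, y); rewrite ?inE.
    by rewrite inE /= => e [-> ->].
  by symmetry; apply/imsetP => -[].
have := sum_card_fibres _ _ (fun x y : 'F_p => y ^+ 2 == x ^+ 3 + a * x + b).
under [in X in _ = X -> _]eq_bigr do rewrite card_sqrt_Fp.
by rewrite big_split /= sumr_const_Fp mulr1 intS => ->; ring.
Qed.

End QuadraticCharacter.

(** * Pairs of proportional values *)

(** By Fermat, [x ^+ (2 * p - 1) = x], and the congruence makes [2 * p - 1]
    a multiple of 3: the power [(2 * p - 1) / 3] inverts cubing. *)
Lemma cube_bij_Fp (p : nat) : prime p -> p = 5 %[mod 6] ->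
  bijective (fun x : 'F_p => x ^+ 3).
Proof.
move=> p_prime p_mod6.
have fermat (x : 'F_p) : x ^+ (3 * (p %/ 6 * 4 + 3)) = x.
  rewrite (_ : (3 * _)%N = (p + p.-1)%N); last by lia.
  have expFp : x ^+ p = x by have := expf_card x; rewrite card_Fp.
  by rewrite exprD expFp -exprS prednK ?prime_gt0.
exists (fun x => x ^+ (p %/ 6 * 4 + 3)) => x; first by rewrite -exprM.
by rewrite -exprM mulnC.
Qed.

(** The condition factors as [(m - 1) * (m * (m + 1) * x ^+ 3 - b) = 0]. The
    weight [legendre p m] absorbs the irregular count at [m = 0]. *)
Lemma card_proportional (p : nat) (b m : 'F_p) :
  prime p -> p = 5 %[mod 6] -> b != 0 ->
  legendre p m *
      \sum_(x : 'F_p | x != 0) ((m * x) ^+ 3 + b - m * (x ^+ 3 + b) == 0)%:R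
    = legendre p m + (m == 1)%:R * (p%:Z - 2)
      - (m == -1)%:R * legendre p (-1).
Proof.
move=> p_prime p_mod6 b0.
have p_odd : odd p by lia.
have one_neq : (1 : 'F_p) != -1 by rewrite oppr_neq_Fp ?oner_neq0.
have [->|m0] := eqVneq m 0.
  rewrite legendre0 mul0r [0 == 1]eq_sym oner_eq0.
  by rewrite [0 == -1]eq_sym oppr_eq0 oner_eq0 !mul0r subr0.
have factor (x : 'F_p) : (m * x) ^+ 3 + b - m * (x ^+ 3 + b) =
  (m - 1) * (m * (m + 1) * x ^+ 3 - b) by ring.
under eq_bigr do rewrite factor mulf_eq0.
have [->|m1] := eqVneq m 1.
  rewrite (negPf one_neq) subrr eqxx legendre1 //=.
  by rewrite sum_nonzero_Fp //; lia.
rewrite subr_eq0 (negPf m1) /=.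
have [->|mN1] := eqVneq m (-1).
  rewrite big1 ?mulr0 => [|x _]; first by lia.
  by rewrite addNr mulr0 mul0r sub0r oppr_eq0 (negPf b0).
have mm0 : m * (m + 1) != 0 by rewrite mulf_neq0 // addr_eq0.
have [root cubeK rootK] := cube_bij_Fp p p_prime p_mod6.
pose r := root ((m * (m + 1))^-1 * b).
have solE (x : 'F_p) : (m * (m + 1) * x ^+ 3 - b == 0) = (x == r).
  by rewrite subr_eq0 (can2_eq (mulKf mm0) (mulVKf mm0)) (can2_eq cubeK rootK).
under eq_bigr do rewrite solE.
have r0 : r != 0 by rewrite eq_sym -solE expr0n mulr0 sub0r oppr_eq0.
rewrite (bigD1 r) //= eqxx big1 => [|x /andP[_ /negPf-> //]].
by rewrite !mul0r; lia.
Qed.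

(** * The second moment *)

Theorem theorem4 (p : nat) (p_prime : prime p) (p_mod6 : p = 5 %[mod 6])
    (b : 'F_p) (b_neq0 : b != 0) :
  \sum_(t : 'F_p) frob_trace p t b ^+ 2
    = p%:Z * (p%:Z - 1 - legendre p (-1)).
Proof.
have p_odd : odd p by lia.
pose chi := legendre p.
pose g (x t : 'F_p) := x ^+ 3 + t * x + b.
have -> : \sum_(t : 'F_p) frob_trace p t b ^+ 2 =
    \sum_(x : 'F_p) \sum_(y : 'F_p) \sum_(t : 'F_p) chi (g x t) * chi (g y t).
  under eq_bigr do rewrite frob_traceE // sqrrN expr2 big_distrlr /=.
  by rewrite exchange_big; apply: eq_bigr => x _; rewrite exchange_big.
rewrite (bigD1 0) //=.
have -> : \sum_(y : 'F_p) \sum_(t : 'F_p) chi (g 0 t) * chi (g y t) = p%:Z.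
  have g0 t : g 0 t = b by rewrite /g expr0n mulr0 !add0r.
  rewrite (bigD1 0) //= [X in _ + X]big1 => [|y y0].
    under eq_bigr do rewrite g0 legendreM_self // b_neq0.
    by rewrite sumr_const_Fp // mulr1 addr0.
  under eq_bigr do rewrite g0.
  rewrite -mulr_sumr (eq_bigr (fun t => chi (y * t + (y ^+ 3 + b)))).
    by rewrite sum_legendre_affine // mulr0.
  by move=> t _; congr chi; rewrite /g; ring.
pose c (x m : 'F_p) := (m * x) ^+ 3 + b - m * (x ^+ 3 + b).
have corr (x : 'F_p) : x != 0 ->
    \sum_(y : 'F_p) \sum_(t : 'F_p) chi (g x t) * chi (g y t) =
    p%:Z * \sum_(m : 'F_p) chi m * (c x m == 0)%:R.
  move=> x0; rewrite (reindex_inj (mulIf x0)) /=.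
  transitivity (\sum_(m : 'F_p) chi m * (p%:Z * (c x m == 0)%:R - 1)).
    apply: eq_bigr => m _; rewrite -sum_legendre_affine_corr //.
    (* The new variable is the value [s = g x t], affine in [t]. *)
    rewrite [RHS](reindex_inj (h := g x)) /= => [|t u].
      by apply: eq_bigr => t _; congr (_ * chi _); rewrite /g /c; ring.
    by move=> /addIr/addrI/(mulIf x0).
  under [LHS]eq_bigr do rewrite mulrBr mulr1 mulrCA.
  by rewrite sumrB sum_legendre // subr0 mulr_sumr.
rewrite (eq_bigr _ corr) -mulr_sumr exchange_big /=.
under eq_bigr do rewrite -mulr_sumr card_proportional //.
have pick1 (u : 'F_p) (k : int) : \sum_(m : 'F_p) (m == u)%:R * k = k.
  by rewrite (bigD1 u) //= eqxx mul1r big1 ?addr0 // => m /negPf->; rewrite mul0r.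
by rewrite sumrB big_split /= sum_legendre // !pick1; ring.
Qed.
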